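(* For $n\geq0$, \[u_{2n+1}=\sum_{i+j=2n}u_iu_j,\] where the sum is over integers $i,j\ge 0$, and, with $U_e(x)=\sum_{n\geq0}u_{2n}x^{2n}$ and $U_o(x)=\sum_{n\geq0}u_{2n+1}x^{2n+1}$, \[U_o(x)=x\left(U_o^2(x)+U_e^2(x)\right).\]
   Context: For a multiset $M$ of positive integers, a permutation of $M$ is a word using each element of $M$ with its multiplicity. A word $w_1\cdots w_m$ contains the pattern $132$ if there are $a<b<c$ with $w_a<w_c<w_b$; otherwise it is $132$-avoiding. Define $u_{2n}$ as the number of $132$-avoiding permutations of the multiset $\{1^2,2^2,\dots,n^2\}$ (each of $1,\dots,n$ appearing twice) and $u_{2n+1}$ as the number of $132$-avoiding permutations of $\{1^2,2^2,\dots,n^2,n+1\}$, for $n\ge 0$; so $u_0=1$, and $u_m=0$ for $m<0$. *)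

(* Defs.v *)
From mathcomp Require Import all_boot all_order all_algebra.

Set Implicit Arguments.
Unset Strict Implicit.
Unset Printing Implicit Defensive.

Import GRing.Theory.

Definition contains132 (w : seq nat) : bool :=
  [exists a : 'I_(size w), exists b : 'I_(size w), exists c : 'I_(size w),
    (a < b < c) && (nth 0 w a < nth 0 w c < nth 0 w b)].

Definition avoids132 (w : seq nat) : bool := ~~ contains132 w.

(* Multisets are represented by a list of their elements; by construction
   permutations lists each distinct rearrangement exactly once, also in the
   presence of repeated letters. *)
Definition num_avoiders (M : seq nat) : nat := count avoids132 (permutations M).

(* {1^2, 2^2, ..., n^2} *)
Definition doubled (n : nat) : seq nat :=
  flatten [seq [:: i; i] | i <- iota 1 n].

Definition u (m : nat) : nat :=
  if odd m then num_avoiders (rcons (doubled m./2) m./2.+1)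
  else num_avoiders (doubled m./2).

Local Open Scope ring_scope.

(* Formal power series over int, as coefficient sequences: f k is the
   coefficient of x^k.  Equality of series is pointwise equality (=1). *)
Definition fps : Type := nat -> int.

Definition fps_add (f g : fps) : fps := fun k => f k + g k.

Definition fps_mul (f g : fps) : fps :=
  fun k => \sum_(i < k.+1) f i * g (k - i)%N.

Definition fps_X : fps := fun k => (k == 1%N)%:R.

Definition Ue : fps := fun k => if odd k then 0 else (u k)%:R.

Definition Uo : fps := fun k => if odd k then (u k)%:R else 0.

(* Main.v *)
Require Import Defs.
From mathcomp Require Import all_boot all_order all_algebra.

Set Implicit Arguments.
Unset Strict Implicit.
Unset Printing Implicit Defensive.

Import GRing.Theory.

(** Cutting an avoider of [{1^2, ..., n^2, n+1}] at its unique maximum [n+1] gives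
    [L (n+1) R] with [L] and [R] avoiding and every letter of [L] at least every
    letter of [R], so that [R] consists of the [j] smallest letters and [L] of the
    others.  The letters of [R] have the shape counted by [u j]; those of [L] do so
    up to a shift when [j] is even, but for odd [j] the unpaired letter of [L] is its
    smallest one instead of its largest.

    That this does not change the number of avoiders is seen by building words from
    the largest letter down.  A letter [x] not exceeding those present may be
    inserted, as the last [x], exactly when what follows it is weakly increasing.
    If [s] is the length of the longest weakly increasing suffix, then a new minimum
    leads to the lengths [1, ..., s+1], once each, and a second copy of the minimum
    to the same lengths except [s].  So on weights [g(s)] the two insertions act as
    [T] and [T - 1], which commute, and the unpaired letter can be moved from one
    end to the other. *)

(** * Recursive form of 132-avoidance *)

Definition ok_after (a y z : nat) : bool := (z <= a) || (y <= z).

Fixpoint avoids (w : seq nat) : bool :=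
  if w is a :: w' then pairwise (ok_after a) w' && avoids w' else true.

Lemma contains132P w :
  reflect (exists a b c, [/\ a < b < c, c < size w &
                            nth 0 w a < nth 0 w c < nth 0 w b])
          (contains132 w).
Proof.
apply: (iffP existsP) => [[a /existsP[b /existsP[c /andP[abc pat]]]]|].
  by exists a, b, c.
move=> [a [b [c [/andP[ab bc] cw pat]]]].
have bw := ltn_trans bc cw; have aw := ltn_trans ab bw.
exists (Ordinal aw); apply/existsP; exists (Ordinal bw).
by apply/existsP; exists (Ordinal cw); rewrite /= ab bc.
Qed.

Lemma avoids132_cons a w :
  avoids132 (a :: w) = pairwise (ok_after a) w && avoids132 w.
Proof.
apply/idP/andP => [av|[pw av]].
  split.
    apply/(pairwiseP 0) => b c; rewrite !inE => bw cw bc.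
    rewrite /ok_after leqNgt [X in _ || X]leqNgt -negb_and.
    apply: contra av => pat; apply/contains132P.
    by exists 0, b.+1, c.+1.
  apply: contra av => /contains132P[i [b [c [ibc cw pat]]]].
  by apply/contains132P; exists i.+1, b.+1, c.+1.
apply/contains132P => -[i [b [c [/andP[ib bc] cw pat]]]].
case: b ib bc pat => // b ib; case: c cw => // c cw bc.
case: i ib => [|i] ib /= pat.
  have := pairwiseP 0 pw b c; rewrite !inE => /(_ (ltn_trans bc cw) cw bc).
  by rewrite /ok_after leqNgt [X in _ || X]leqNgt -negb_and pat.
by case/contains132P: av; exists i, b, c; split=> //; apply/andP.
Qed.

Lemma avoids132E : avoids132 =1 avoids.
Proof.
elim=> [|a w IHw]; last by rewrite avoids132_cons IHw.
by apply/contains132P => -[a [b [c []]]].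
Qed.

(** As no letter of [P] lies below [x], [x] cannot be the 3 or the 2 of a pattern; it can only be
    the 1, followed by two letters of [Q]. *)
Lemma avoids_insert_min x P Q : all (leq x) P ->
  avoids (P ++ x :: Q) = avoids (P ++ Q) && pairwise (ok_after x) Q.
Proof.
elim: P => [|a P IHP] /=; first by rewrite andbC.
case/andP=> xa xP; rewrite IHP // !andbA; congr (_ && _ && _).
rewrite !pairwise_cat allrel_consr /=.
have -> : all ((ok_after a)^~ x) P by apply/allP => y _; rewrite /ok_after xa.
have -> // : all (ok_after a x) Q.
apply/allP => z _; rewrite /ok_after; case: leqP => //= az.
exact: leq_trans xa (ltnW az).
Qed.

(** With [m] as the 3, a letter of [L] below a letter of [R] gives a pattern. If there is no such
    pair, no pattern starts in [L] and ends in [R], and [m], being largest, is neither a 1 nor a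
    2. *)
Lemma avoids_split_max m L R : all (ltn^~ m) L -> all (ltn^~ m) R ->
  avoids (L ++ m :: R) = [&& avoids L, avoids R & allrel geq L R].
Proof.
move=> + Rm; elim: L => [_|a L IHL /= /andP[am Lm]] /=.
  rewrite andbT; case: (avoids R); rewrite ?andbF ?andbT //.
  apply/(pairwiseP 0) => i j _; rewrite inE => jR _.
  by apply/orP; left; apply: ltnW (allP Rm _ (mem_nth 0 jR)).
rewrite IHL // pairwise_cat allrel_consr allrel_consl /=.
have -> : all ((ok_after a)^~ m) L.
  by apply/allP => y /(allP Lm) /= ym; rewrite /ok_after (ltnW ym) orbT.
have -> : all (ok_after a m) R = all (geq a) R.
  apply: eq_in_all => z /(allP Rm) /= zm.
  by rewrite /ok_after [m <= z]leqNgt zm orbF.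
case Ra: (all (geq a) R); rewrite ?andbF ?andbT //=.
have sub y z : z \in R -> ok_after a y z.
  by move=> /(allP Ra) /= za; rewrite /ok_after za.
have -> : allrel (ok_after a) L R.
  by apply/allrelP => y z _; apply: sub.
have -> : pairwise (ok_after a) R.
  by apply/(pairwiseP 0) => i j _; rewrite inE => jR _; rewrite sub ?mem_nth.
by rewrite andbT andbA.
Qed.

(** * Weakly increasing suffixes *)

(* Words are read backwards from here on, so that the weakly increasing suffix of
   a word becomes a weakly decreasing prefix. *)
Fixpoint decr_prefix (r : seq nat) : nat :=
  if r is y :: r' then
    (if r' is z :: _ then (z <= y) * decr_prefix r' else 0).+1
  else 0.

Lemma sorted_take_decr_prefix k r :
  k <= size r -> sorted geq (take k r) = (k <= decr_prefix r).
Proof.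
elim: r k => [|y [|z r] IHr] [|[|k]] // kr.
have := IHr k.+1 kr; rewrite !take_cons /= => ->.
by rewrite ltnS; case: (z <= y); rewrite /= ?mul1n ?mul0n.
Qed.

Lemma decr_prefix_cat x P Q : sorted geq P -> all (leq x) P ->
  decr_prefix (P ++ x :: Q) = size P + decr_prefix (x :: Q).
Proof.
elim: P => [|y [|z P] IHP] //.
  by move=> _ /=; rewrite andbT => ->; rewrite mul1n.
move=> /andP[zy sP] /andP[xy xP].
have {}IHP := IHP sP xP; rewrite /geq /= in zy.
by rewrite !cat_cons /= zy mul1n in IHP *; rewrite IHP.
Qed.

Lemma decr_prefix_min x Q : all (ltn x) Q -> decr_prefix (x :: Q) = 1.
Proof. by case: Q => // z Q /= /andP[xz _]; rewrite leqNgt xz. Qed.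

Lemma decr_prefix_size r : decr_prefix r <= size r.
Proof.
elim: r => //= y [|z r] //= IHr; rewrite ltnS.
by case: (z <= y); rewrite ?mul0n // mul1n.
Qed.

(** * Insertion of a letter at a given position *)

Definition insert_at (T : Type) (x : T) (r : seq T) (k : nat) : seq T :=
  take k r ++ x :: drop k r.

Lemma drop_insert_at (T : Type) (x : T) r k :
  k <= size r -> drop k (insert_at x r k) = x :: drop k r.
Proof. by move=> kr; rewrite drop_size_cat // size_takel. Qed.

Lemma index_insert_at (T : eqType) (x : T) r k :
  k <= index x r -> index x (insert_at x r k) = k.
Proof.
move=> kx; have kr := leq_trans kx (index_size x r).
rewrite /insert_at index_cat size_takel //= eqxx addn0.
by rewrite in_take_leq // ltnNge kx.
Qed.

Lemma rem_insert_at (T : eqType) (x : T) r k :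
  k <= index x r -> rem x (insert_at x r k) = r.
Proof.
move=> kx; have kr := leq_trans kx (index_size x r).
rewrite remE index_insert_at // /insert_at take_size_cat ?size_takel //.
by rewrite -cat_rcons drop_size_cat ?size_rcons ?size_takel // cat_take_drop.
Qed.

Lemma insert_at_rem (T : eqType) (x : T) r :
  x \in r -> insert_at x (rem x r) (index x r) = r.
Proof.
move=> xr; rewrite remE /insert_at.
have sx : index x r <= size r by rewrite index_size.
rewrite take_size_cat ?size_takel // drop_size_cat ?size_takel //.
by rewrite -{2}(nth_index x xr) -drop_nth ?index_mem // cat_take_drop.
Qed.

Lemma index_rem (T : eqType) (x : T) r : x \in r -> index x r <= index x (rem x r).
Proof.
move=> xr; rewrite remE index_cat size_takel ?index_size //.
by rewrite in_take_leq ?index_size // ltnn leq_addr.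
Qed.

(* Inserting [x] no later than its first occurrence makes each word arise once. *)
Lemma perm_permutations_cons (T : eqType) (x : T) M :
  perm_eq (permutations (x :: M))
    [seq insert_at x r k | r <- permutations M, k <- iota 0 (index x r).+1].
Proof.
apply: uniq_perm; first exact: permutations_uniq.
  apply: allpairs_uniq_dep => [|r _|]; rewrite ?permutations_uniq ?iota_uniq //.
  move=> _ _ /allpairsPdep[r [k [_ + ->]]] /allpairsPdep[r' [k' [_ + ->]]] /=.
  rewrite !mem_iota !ltnS /= => kr kr' eq_ins.
  have -> : k = k' by rewrite -(index_insert_at kr) eq_ins index_insert_at.
  by have -> : r = r' by rewrite -(rem_insert_at kr) eq_ins rem_insert_at.
move=> w; rewrite mem_permutations; apply/idP/allpairsPdep => [pw|].
  have xw : x \in w by rewrite (perm_mem pw) mem_head.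
  exists (rem x w), (index x w); rewrite insert_at_rem // mem_permutations.
  rewrite mem_iota ltnS index_rem //; split=> //.
  by rewrite -(perm_cons x) -(permPl (perm_to_rem xw)).
move=> [r [k []]]; rewrite mem_permutations => rM _ ->.
by rewrite /insert_at -cat1s perm_catCA cat_take_drop perm_cons.
Qed.

Lemma rev_insert_at (T : Type) (x : T) r k :
  rev (insert_at x r k) = rev (drop k r) ++ x :: rev (take k r).
Proof. by rewrite /insert_at rev_cat rev_cons cat_rcons. Qed.

Lemma all_gt_take x r k : all (leq x) r -> k <= index x r ->
  all (ltn x) (take k r).
Proof.
move=> xr kx; apply/allP => y yt /=.
have xy : x <= y := allP xr _ (mem_take yt).
rewrite ltn_neqAle xy andbT; apply: contraTneq yt => <-.
by rewrite in_take_leq ?(leq_trans kx) ?index_size // -leqNgt.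
Qed.

(** The letters of [take k r], which follow [x] in the reversed word, all exceed [x] because
    [k <= index x r]; on such letters [ok_after x] is just [leq]. *)
Lemma avoids_rev_insert x r k : all (leq x) r -> k <= index x r ->
  avoids (rev (insert_at x r k)) = avoids (rev r) && (k <= decr_prefix r).
Proof.
move=> xr kx; rewrite rev_insert_at avoids_insert_min; last first.
  by rewrite all_rev; apply/allP => y /mem_drop /(allP xr).
rewrite -rev_cat cat_take_drop; congr (_ && _).
rewrite -sorted_take_decr_prefix ?(leq_trans kx) ?index_size //.
rewrite -(rev_sorted leq) (sorted_pairwise leq_trans).
apply: (@eq_in_pairwise _ (ltn x)); last by rewrite all_rev all_gt_take.
by move=> y z _ xz; rewrite /ok_after leqNgt [x < z]xz.
Qed.

Lemma decr_prefix_insert x r k : all (leq x) r -> k <= index x r ->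
  k <= decr_prefix r ->
  decr_prefix (insert_at x r k) = k + decr_prefix (x :: drop k r).
Proof.
move=> xr kx kd; have kr := leq_trans kx (index_size x r).
rewrite /insert_at decr_prefix_cat ?size_takel ?sorted_take_decr_prefix //.
by apply/allP => y /mem_take /(allP xr).
Qed.

(** * Weighted sums over avoiders *)

Definition avoider_sum (M : seq nat) (g : nat -> int) : int :=
  (\sum_(r <- permutations M | avoids (rev r)) g (decr_prefix r))%R.

(* Effect on weights of inserting a letter below the current minimum, and of
   inserting a second copy of a minimum that occurs once. *)
Definition new_min (g : nat -> int) (s : nat) : int :=
  (\sum_(0 <= k < s.+1) g k.+1)%R.

Definition repeat_min (g : nat -> int) (s : nat) : int :=
  (new_min g s - g s)%R.

Lemma avoider_sum_cons x M g : all (leq x) M ->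
  avoider_sum (x :: M) g =
  (\sum_(r <- permutations M | avoids (rev r))
     \sum_(0 <= k < (index x r).+1 | (k <= decr_prefix r)%N)
       g (k + decr_prefix (x :: drop k r))%N)%R.
Proof.
move=> xM; rewrite /avoider_sum big_mkcond (perm_big _ (perm_permutations_cons x M)).
rewrite big_allpairs_dep [RHS]big_mkcond; apply: eq_big_seq => r.
rewrite mem_permutations => rM; have xr : all (leq x) r by rewrite (perm_all _ rM).
under eq_big_seq => k.
  rewrite mem_iota /= ltnS => kx; rewrite avoids_rev_insert //.
  over.
case: ifP => _; last exact: big1.
rewrite -big_mkcond /index_iota subn0 [LHS]big_seq_cond [RHS]big_seq_cond.
apply: eq_bigr => k /andP[]; rewrite mem_iota ltnS => kx kd.
by rewrite decr_prefix_insert.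
Qed.

Lemma avoider_sum_new_min x M g : all (ltn x) M ->
  avoider_sum (x :: M) g = avoider_sum M (new_min g).
Proof.
move=> xM; rewrite avoider_sum_cons; last by apply: sub_all xM => y /ltnW.
rewrite /avoider_sum [LHS]big_seq_cond [RHS]big_seq_cond; apply: eq_bigr => r /andP[+ _].
rewrite mem_permutations => rM; have xr : all (ltn x) r by rewrite (perm_all _ rM).
have -> : index x r = size r.
  by apply: memNindex; apply/negP => /(allP xr); rewrite /= ltnn.
(* Since [decr_prefix r <= size r], the condition [k <= decr_prefix r] is the effective bound. *)
rewrite /new_min [RHS](big_nat_widen _ _ (size r).+1) ?ltnS ?decr_prefix_size //.
apply: eq_big => [k|k _]; first by rewrite ltnS.
rewrite decr_prefix_min ?addn1 //.
by apply/allP => y /mem_drop /(allP xr).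
Qed.

(** The only [x] of [r] ends the decreasing prefix, whose length is thus [p.+1] for [p = index x r].
    A new copy at [k < p] is followed by a larger letter, giving length [k.+1]; at [k = p] the two
    copies are adjacent, giving [p.+2]. Only [p.+1] is skipped. *)
Lemma avoider_sum_repeat_min x M g : all (ltn x) M ->
  avoider_sum [:: x, x & M] g = avoider_sum (x :: M) (repeat_min g).
Proof.
move=> xM; rewrite avoider_sum_cons; last first.
  by rewrite /= leqnn; apply: sub_all xM => y /ltnW.
rewrite /avoider_sum [LHS]big_seq_cond [RHS]big_seq_cond; apply: eq_bigr => r /andP[].
rewrite mem_permutations => rM av.
have xr : x \in r by rewrite (perm_mem rM) mem_head.
have vM : perm_eq (rem x r) M.
  by rewrite -(perm_cons x) -(permPl (perm_to_rem xr)).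
have xv : all (ltn x) (rem x r) by rewrite (perm_all _ vM).
have xv' : all (leq x) (rem x r) by apply: sub_all xv => y /ltnW.
have xD k : all (ltn x) (drop k (rem x r)).
  by apply/allP => y /mem_drop /(allP xv).
have px := index_rem xr; have rE := insert_at_rem xr.
have pd : index x r <= decr_prefix (rem x r).
  by move: av; rewrite -{1}rE avoids_rev_insert // => /andP[].
have dE : decr_prefix r = (index x r).+1.
  by rewrite -[in LHS]rE decr_prefix_insert // decr_prefix_min // addn1.
rewrite dE /repeat_min /new_min big_mkcond [RHS]addrC.
rewrite !big_nat_recr // leqnSn.
have := drop_insert_at x (leq_trans px (index_size x _)); rewrite rE => ->.
have -> : decr_prefix [:: x, x & drop (index x r) (rem x r)] = 2.
  by have := decr_prefix_min (xD (index x r)); rewrite /= leqnn mul1n => ->.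
(* The summand of [new_min] at [k = index x r] cancels the subtracted [g (decr_prefix r)]. *)
rewrite addn2 addrA [(- _ + _)%R]addrC addrK; congr (_ + _)%R.
apply: eq_big_nat => k /andP[_ kp]; rewrite ltnW ?(ltn_trans kp) //.
have kr : k < size r by rewrite (ltn_trans kp) // index_mem.
rewrite (drop_nth 0 kr) /= leqNgt.
suff -> : x < nth 0 r k by rewrite addn1.
apply: (allP (all_gt_take _ (leqnn (index x r)))).
  by rewrite (perm_all _ rM) /= leqnn; apply: sub_all xM => y /ltnW.
by rewrite -(nth_take 0 kp) mem_nth // size_takel // index_size.
Qed.

(** * Commutation of the insertion operators *)

Lemma eq_new_min g h : g =1 h -> new_min g =1 new_min h.
Proof. by move=> gh s; apply: eq_bigr. Qed.

Lemma eq_repeat_min g h : g =1 h -> repeat_min g =1 repeat_min h.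
Proof. by move=> gh s; rewrite /repeat_min gh (eq_new_min gh). Qed.

Lemma new_minC g : new_min (repeat_min g) =1 repeat_min (new_min g).
Proof. by move=> s; rewrite /new_min /repeat_min sumrB. Qed.

Definition double_min (g : nat -> int) : nat -> int := new_min (repeat_min g).

Lemma new_min_iter n g :
  new_min (iter n double_min g) =1 iter n double_min (new_min g).
Proof.
elim: n => //= n IHn s; apply: eq_new_min => {}s.
by rewrite -(eq_repeat_min IHn) -new_minC.
Qed.

(** * Doubled multisets with an unpaired letter *)

Definition doubled_from (a n : nat) : seq nat :=
  flatten [seq [:: i; i] | i <- iota a n].

Lemma doubled_fromS a n :
  doubled_from a n.+1 = [:: a, a & doubled_from a.+1 n].
Proof. by []. Qed.

Lemma all_doubled_from x a n : x < a -> all (ltn x) (doubled_from a n).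
Proof.
elim: n a => // n IHn a xa; rewrite doubled_fromS /= !xa /=.
exact: IHn (leqW xa).
Qed.

Lemma avoider_sum_double_min x M g : all (ltn x) M ->
  avoider_sum [:: x, x & M] g = avoider_sum M (double_min g).
Proof. by move=> xM; rewrite avoider_sum_repeat_min // avoider_sum_new_min. Qed.

Lemma avoider_sum_doubled a n g :
  avoider_sum (doubled_from a n) g = iter n double_min g 0.
Proof.
elim: n a g => [|n IHn] a g.
  by rewrite /avoider_sum big_mkcond big_seq1.
by rewrite doubled_fromS avoider_sum_double_min ?all_doubled_from // IHn iterSr.
Qed.

(** Letters are peeled off from the smallest up, so the final [m] leaves [new_min] outermost;
    [new_min_iter] moves it inside, the form obtained directly when the unpaired letter is the
    smallest. *)
Lemma avoider_sum_doubled_rcons a n m g : a + n <= m ->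
  avoider_sum (rcons (doubled_from a n) m) g = iter n double_min (new_min g) 0.
Proof.
rewrite -new_min_iter; elim: n a g => [|n IHn] a g anm.
  by rewrite avoider_sum_new_min // [LHS](avoider_sum_doubled 0 0).
rewrite doubled_fromS !rcons_cons avoider_sum_double_min.
  by rewrite IHn ?iterSr // addSnnS.
rewrite all_rcons all_doubled_from // andbT /=.
by apply: leq_trans anm; rewrite addnS ltnS leq_addr.
Qed.

Lemma avoider_sum_doubled_cons x a n g : x < a ->
  avoider_sum (x :: doubled_from a n) g = iter n double_min (new_min g) 0.
Proof.
move=> xa; rewrite avoider_sum_new_min ?all_doubled_from //.
exact: avoider_sum_doubled.
Qed.

Lemma num_avoidersE M : (num_avoiders M)%:R%R = avoider_sum M (fun=> 1%R).
Proof.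
rewrite /num_avoiders (eq_count avoids132E) /avoider_sum big_const_seq.
rewrite iter_addr addr0 -(count_map rev avoids); congr (_ *+ _)%R.
apply: (permP _ avoids); apply: uniq_perm;
  rewrite ?(map_inj_uniq (can_inj revK)) ?permutations_uniq //.
move=> w; rewrite -{2}(revK w) (mem_map (can_inj revK)) !mem_permutations.
by rewrite perm_rev.
Qed.

Lemma num_avoiders_eq M N :
  avoider_sum M (fun=> 1%R) = avoider_sum N (fun=> 1%R) ->
  num_avoiders M = num_avoiders N.
Proof. by rewrite -!num_avoidersE !natz => -[]. Qed.

Lemma u_even n a : num_avoiders (doubled_from a n) = u n.*2.
Proof.
rewrite /u odd_double doubleK; apply: num_avoiders_eq.
by rewrite avoider_sum_doubled -[doubled n]/(doubled_from 1 n) avoider_sum_doubled.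
Qed.

Lemma u_odd_rcons n a m : a + n <= m ->
  num_avoiders (rcons (doubled_from a n) m) = u n.*2.+1.
Proof.
move=> anm; rewrite /u /= odd_double uphalf_double.
apply: num_avoiders_eq.
by rewrite -[doubled n]/(doubled_from 1 n) !avoider_sum_doubled_rcons.
Qed.

Lemma u_odd_cons n x a : x < a ->
  num_avoiders (x :: doubled_from a n) = u n.*2.+1.
Proof.
move=> xa; rewrite -(u_odd_rcons (leqnn (0 + n))); apply: num_avoiders_eq.
by rewrite avoider_sum_doubled_cons // avoider_sum_doubled_rcons.
Qed.

(** * Cutting at the maximum *)

(** Both [s] and [sort leq R ++ sort leq L] are sorted rearrangements of the same letters, hence
    equal. *)
Lemma sorted_cat_take (L R s : seq nat) : sorted leq s -> perm_eq (L ++ R) s ->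
  allrel geq L R -> perm_eq L (drop (size R) s) /\ perm_eq R (take (size R) s).
Proof.
move=> s_sorted LRs LR.
have -> : s = sort leq R ++ sort leq L.
  apply: (sorted_eq leq_trans anti_leq) => //.
    rewrite (sorted_pairwise leq_trans) pairwise_cat -!(sorted_pairwise leq_trans).
    rewrite !(sort_sorted leq_total) !andbT.
    by apply/allrelP => y z; rewrite !mem_sort => yR zL; apply: (allrelP LR).
  by rewrite -(permPl LRs) perm_catC perm_cat // perm_sym perm_sort.
rewrite drop_size_cat ?take_size_cat ?size_sort //.
by rewrite !(perm_sym L) !(perm_sym R) !perm_sort.
Qed.

Lemma num_avoiders_split_max s m : sorted leq s -> all (ltn^~ m) s ->
  num_avoiders (rcons s m) =
  \sum_(0 <= j < (size s).+1) num_avoiders (drop j s) * num_avoiders (take j s).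
Proof.
move=> s_sorted sm.
pose av M := [seq w <- permutations M | avoids w].
have numE M : num_avoiders M = size (av M).
  by rewrite /num_avoiders (eq_count avoids132E) size_filter.
pose glue (p : seq nat * seq nat) := p.1 ++ m :: p.2.
(* Here [j] is the number of letters after [m]; these must be the [j] smallest letters of [s]. *)
pose words := [seq glue p | j <- iota 0 (size s).+1,
  p <- [seq (L, R) | L <- av (drop j s), R <- av (take j s)]].
have pieceP j p :
    reflect [/\ avoids p.1, perm_eq p.1 (drop j s), avoids p.2 & perm_eq p.2 (take j s)]
      (p \in [seq (L, R) | L <- av (drop j s), R <- av (take j s)]).
  apply: (iffP allpairsP) => [[q [+ + ->]]|[aL pL aR pR]].
    by rewrite !mem_filter !mem_permutations => /andP[? ?] /andP[].
  by exists p; rewrite !mem_filter !mem_permutations aL pL aR pR; case: p {aL pL aR pR}.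
have drop_lt j : all (ltn^~ m) (drop j s) by apply/allP => y /mem_drop /(allP sm).
have take_lt j : all (ltn^~ m) (take j s) by apply/allP => y /mem_take /(allP sm).
have lt_notin L : all (ltn^~ m) L -> m \notin L.
  by move=> Lm; apply/negP => /(allP Lm); rewrite /= ltnn.
have: perm_eq (av (rcons s m)) words.
  apply: uniq_perm; first by rewrite filter_uniq ?permutations_uniq.
    apply: allpairs_uniq_dep => [|j _|]; rewrite ?iota_uniq //.
      by apply: allpairs_uniq; rewrite ?filter_uniq ?permutations_uniq // => -[? ?] [].
    move=> _ _ /allpairsPdep[j [[L R] [js /pieceP[_ pL _ pR] ->]]]
      /allpairsPdep[j' [[L' R'] [js' /pieceP[_ pL' _ pR'] ->]]].
    rewrite /glue /= in pL pR pL' pR' * => eqw.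
    have mL : m \notin L by rewrite lt_notin // (perm_all _ pL).
    have mL' : m \notin L' by rewrite lt_notin // (perm_all _ pL').
    (* As [m] occurs in neither left part, its first position recovers the cut. *)
    have szL : size L = size L'.
      have := congr1 (index m) eqw.
      by rewrite !index_cat (negPf mL) (negPf mL') /= eqxx !addn0.
    have /eqP := eqw; rewrite eqseq_cat // eqseq_cons eqxx => /andP[/eqP LL' /eqP RR'].
    have -> : j = j'; last by rewrite LL' RR'.
    have := perm_size pR; rewrite RR' (perm_size pR').
    rewrite !mem_iota !ltnS in js js'; by rewrite !size_takel.
  move=> w; rewrite mem_filter mem_permutations; apply/andP/allpairsPdep.
    move=> [aw pw]; have mw : m \in w by rewrite (perm_mem pw) mem_rcons mem_head.
    case/splitPr: mw aw pw => L R aw.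
    rewrite -[m :: R]cat1s perm_catCA -cats1 perm_sym perm_catC perm_cons perm_sym => pw.
    have LRm : all (ltn^~ m) (L ++ R) by rewrite (perm_all _ pw).
    move: LRm aw; rewrite all_cat => /andP[Lm Rm].
    rewrite avoids_split_max // => /and3P[aL aR LR].
    have [pL pR] := sorted_cat_take s_sorted pw LR.
    exists (size R), (L, R); split => //; last by apply/pieceP.
    by rewrite mem_iota ltnS -(perm_size pw) size_cat leq_addl.
  move=> [j [[L R] [_ /pieceP/= [aL pL aR pR] ->]]]; rewrite /glue /=.
  rewrite avoids_split_max ?(perm_all _ pL) ?(perm_all _ pR) // aL aR /=; split.
    apply/allrelP => y z; rewrite (perm_mem pL) (perm_mem pR) => yL zR.
    move: s_sorted; rewrite -(cat_take_drop j s) (sorted_pairwise leq_trans).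
    by rewrite pairwise_cat => /andP[/allrelP-/(_ z y zR yL)].
  rewrite -[m :: R]cat1s perm_catCA -cats1 perm_sym perm_catC perm_cons perm_sym.
  by rewrite (permPl (perm_cat pL pR)) perm_catC cat_take_drop.
move=> /perm_size; rewrite -numE => ->.
rewrite size_allpairs_dep sumnE big_map /index_iota subn0; apply: eq_bigr => j _.
by rewrite size_allpairs !numE.
Qed.

(** * The recurrence for odd indices *)

Lemma doubled_from_cat a j k :
  doubled_from a (j + k) = doubled_from a j ++ doubled_from (a + j) k.
Proof. by rewrite /doubled_from iotaD map_cat flatten_cat. Qed.

Lemma size_doubled_from a n : size (doubled_from a n) = n.*2.
Proof. by elim: n a => // n IHn a; rewrite doubled_fromS /= IHn. Qed.

Lemma sorted_doubled_from a n : sorted leq (doubled_from a n).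
Proof.
rewrite (sorted_pairwise leq_trans); elim: n a => // n IHn a.
rewrite doubled_fromS /= leqnn IHn andbT /= andbb.
by apply: sub_all (all_doubled_from n (ltnSn a)) => y /ltnW.
Qed.

Lemma doubled_lt n : all (ltn^~ n.+1) (doubled n).
Proof.
apply/allP => y /flatten_mapP[i]; rewrite mem_iota add1n => /andP[_ iN].
by rewrite !inE orbb => /eqP->.
Qed.

(** An even [j] cuts between pairs. An odd [j] cuts inside one, leaving its letter unpaired as the
    largest of the taken part and the smallest of the dropped part. *)
Lemma num_avoiders_take_drop n j : j <= n.*2 ->
  num_avoiders (drop j (doubled n)) * num_avoiders (take j (doubled n)) =
  u j * u (n.*2 - j).
Proof.
rewrite -[doubled n]/(doubled_from 1 n) mulnC -[j]odd_double_half.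
move: (odd j) (j./2) => b k {j}; case: b => /= [|kn].
  rewrite add1n ltn_double => kn.
  (* The pair being cut consists of the two copies of [1 + k], with [n - k.+1] pairs above it. *)
  have -> : n = k + (n - k.+1).+1 by rewrite subnSK // subnKC // ltnW.
  move: (n - _) => l {n kn}; rewrite doubled_from_cat doubled_fromS.
  rewrite -cat_rcons take_size_cat ?drop_size_cat ?size_rcons ?size_doubled_from //.
  rewrite u_odd_rcons // u_odd_cons //; congr (u _ * u _).
  by rewrite doubleD doubleS addnS subSS addKn.
rewrite add0n in kn *; rewrite leq_double in kn.
rewrite -[in LHS](subnKC kn) doubled_from_cat take_size_cat ?size_doubled_from //.
by rewrite drop_size_cat ?size_doubled_from // !u_even doubleB.
Qed.

Lemma u_odd_sum n : u n.*2.+1 = \sum_(j < n.*2.+1) u j * u (n.*2 - j).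
Proof.
rewrite {1}/u /= odd_double uphalf_double num_avoiders_split_max.
- rewrite -[doubled n]/(doubled_from 1 n) size_doubled_from big_mkord.
  by apply: eq_bigr => j _; rewrite num_avoiders_take_drop // -ltnS.
- exact: (sorted_doubled_from 1).
- exact: doubled_lt.
Qed.

(** * Generating functions *)

Lemma fps_mul_X0 f : fps_mul fps_X f 0 = 0%R.
Proof. by rewrite /fps_mul big_ord1 /fps_X mul0r. Qed.

Lemma fps_mul_XS f k : fps_mul fps_X f k.+1 = f k.
Proof.
rewrite /fps_mul (bigD1 (inord 1)) //= big1 ?addr0.
  by rewrite /fps_X inordK // eqxx mul1r subn1.
move=> i; rewrite -val_eqE /= inordK // /fps_X => /negPf->.
by rewrite mul0r.
Qed.

Theorem theorem3p4 :
  (forall n : nat,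
     u (2 * n).+1 =
     \sum_(i < (2 * n).+1) \sum_(j < (2 * n).+1 | i + j == 2 * n) u i * u j)
  /\ Uo =1 fps_mul fps_X (fps_add (fps_mul Uo Uo) (fps_mul Ue Ue)).
Proof.
split=> [n|k].
  rewrite mul2n u_odd_sum; apply: eq_bigr => i _.
  have le_i : i <= n.*2 by rewrite -ltnS.
  (* The constraint on [i + j] leaves a single [j]. *)
  rewrite (big_pred1 (inord (n.*2 - i))) ?inordK ?ltnS ?leq_subr // => j.
  by rewrite /= -val_eqE /= inordK ?ltnS ?leq_subr // -[RHS](eqn_add2l i) subnKC.
case: k => [|k]; first by rewrite fps_mul_X0.
rewrite fps_mul_XS /fps_add /fps_mul -big_split /= /Uo /=.
case: ifPn => [k_even|]; last first.
  (* For odd [k], [i] and [k - i] have opposite parities, so each product has a zero factor. *)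
  rewrite negbK => k_odd; rewrite big1 // => i _.
  rewrite /Ue oddB -1?ltnS // k_odd.
  by case: (odd i); rewrite ?(mulr0, mul0r) addr0.
have kE : k = k./2.*2 by rewrite even_halfK.
rewrite kE u_odd_sum -kE natr_sum; apply: eq_bigr => i _.
(* For even [k], [i] and [k - i] have equal parity, so exactly one of the two products survives. *)
rewrite /Ue oddB -1?ltnS // (negPf k_even) natrM.
by case: (odd i); rewrite ?(mulr0, mul0r) (add0r, addr0).
Qed.
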